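(* Consider the battery bidding optimization problem (P) defined in the context, with a finite scenario set $\Omega$. For each hour $t\in[T]$ let $\Lambda_t=\{\lambda^{\mathrm{DA}}_{t,\omega}:\omega\in\Omega\}$ be the set of distinct sampled prices at hour $t$. Then there exists an optimal solution to (P) in which every bid price is a sampled price of its hour, i.e. $$p^{\mathrm{sell}}_{t,n}\in\Lambda_t,\qquad p^{\mathrm{buy}}_{t,m}\in\Lambda_t,\qquad \text{for all } t\in[T],\ n,m\in[N].$$
   Context: Notation: $[T]=\{1,\dots,T\}$ and $[N]=\{1,\dots,N\}$ with $T,N\ge 1$; $\mathbb{I}\{A\}=1$ if $A$ holds and $0$ otherwise. Data: a nonempty finite scenario set $\Omega$ with weights $\pi_\omega>0$, $\sum_{\omega\in\Omega}\pi_\omega=1$; real prices $\lambda^{\mathrm{DA}}_{t,\omega}$ for $t\in[T]$, $\omega\in\Omega$; efficiency $\eta\in(0,1]$; hourly power limit $\overline{x}\ge 0$; storage bounds $\underline{s}\le\overline{s}$; initial state of charge $s_0\in[\underline{s},\overline{s}]$; confidence level $\alpha\in(0,1)$; weight $\theta\in[0,1]$. Problem (P): over real variables $x^{\mathrm{sell}}_{t,n},x^{\mathrm{buy}}_{t,n}$ (bid quantities) and $p^{\mathrm{sell}}_{t,n},p^{\mathrm{buy}}_{t,n}$ (bid prices) for $t\in[T],n\in[N]$; $s_1,\dots,s_T$ (expected state of charge); $\tau$ and $(z_\omega)_{\omega\in\Omega}$ (conditional-value-at-risk (CVaR) auxiliary variables); and $(r_\omega)_{\omega\in\Omega}$ (scenario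 revenues), maximize $$\theta\sum_{\omega\in\Omega}\pi_\omega r_\omega-(1-\theta)\Big(\tau+\frac{1}{1-\alpha}\sum_{\omega\in\Omega}\pi_\omega z_\omega\Big)$$ subject to - $r_\omega=\sum_{t\in[T]}\lambda^{\mathrm{DA}}_{t,\omega}\Big(\sum_{n\in[N]}\mathbb{I}\{\lambda^{\mathrm{DA}}_{t,\omega}\ge p^{\mathrm{sell}}_{t,n}\}x^{\mathrm{sell}}_{t,n}-\sum_{n\in[N]}\mathbb{I}\{\lambda^{\mathrm{DA}}_{t,\omega}\le p^{\mathrm{buy}}_{t,n}\}x^{\mathrm{buy}}_{t,n}\Big)$ for all $\omega\in\Omega$; - $z_\omega\ge -r_\omega-\tau$ and $z_\omega\ge 0$ for all $\omega\in\Omega$; - $s_t=s_{t-1}+\sum_{\omega\in\Omega}\pi_\omega\Big(\eta\sum_{n\in[N]}\mathbb{I}\{\lambda^{\mathrm{DA}}_{t,\omega}\le p^{\mathrm{buy}}_{t,n}\}x^{\mathrm{buy}}_{t,n}-\frac1\eta\sum_{n\in[N]}\mathbb{I}\{\lambda^{\mathrm{DA}}_{t,\omega}\ge p^{\mathrm{sell}}_{t,n}\}x^{\mathrm{sell}}_{t,n}\Big)$ for all $t\in[T]$; - $\underline{s}\le s_t\le\overline{s}$ for all $t\in[T]$; - $x^{\mathrm{sell}}_{t,n}\ge 0$, $x^{\mathrm{buy}}_{t,n}\ge 0$ for all $t\in[T],n\in[N]$, and $\sum_{n\in[N]}x^{\mathrm{sell}}_{t,n}\le\overline{x}$, $\sum_{n\in[N]}x^{\mathrm{buy}}_{t,n}\le\overline{x}$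 for all $t\in[T]$; - $p^{\mathrm{sell}}_{t,n}\ge p^{\mathrm{buy}}_{t,m}$ for all $t\in[T]$, $n,m\in[N]$. *)

(* Defs.v *)
From mathcomp Require Import all_boot all_order all_algebra.
From mathcomp Require Import reals.

Set Implicit Arguments.
Unset Strict Implicit.
Unset Printing Implicit Defensive.

Import Order.TTheory GRing.Theory Num.Theory.
Local Open Scope ring_scope.

(* Hours [T], bids [N] and time steps are indexed from 0: the ordinal t : 'I_T
   stands for hour t + 1. *)

Record battery_data (R : realType) (Omega : finType) (T : nat) := BatteryData {
  weight : Omega -> R;
  da_price : 'I_T -> Omega -> R;
  efficiency : R;
  power_limit : R;
  soc_min : R;
  soc_max : R;
  soc_init : R;
  confidence : R;
  risk_weight : R
}.

Record valid_data (R : realType) (Omega : finType) (T : nat)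
    (D : battery_data R Omega T) : Prop := ValidData {
  scenarios_nonempty : (0 < #|Omega|)%N;
  weight_gt0 : forall w, 0 < weight D w;
  weight_sum1 : \sum_(w : Omega) weight D w = 1;
  efficiency_in : 0 < efficiency D <= 1;
  power_limit_ge0 : 0 <= power_limit D;
  soc_min_le_max : soc_min D <= soc_max D;
  soc_init_in : soc_min D <= soc_init D <= soc_max D;
  confidence_in : 0 < confidence D < 1;
  risk_weight_in : 0 <= risk_weight D <= 1
}.

Record decision (R : realType) (Omega : finType) (T N : nat) := Decision {
  xsell : 'I_T -> 'I_N -> R;
  xbuy : 'I_T -> 'I_N -> R;
  psell : 'I_T -> 'I_N -> R;
  pbuy : 'I_T -> 'I_N -> R;
  soc : 'I_T -> R; (* soc y t is the state of charge at the end of hour t *)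
  tau : R;
  excess : Omega -> R; (* the CVaR auxiliary variables z *)
  revenue : Omega -> R
}.

Section BatteryBidding.

Variables (R : realType) (Omega : finType) (T N : nat).
Variable D : battery_data R Omega T.
Implicit Type y : decision R Omega T N.

Definition sold y (t : 'I_T) (w : Omega) : R :=
  \sum_(n < N) (psell y t n <= da_price D t w)%R%:R * xsell y t n.

Definition bought y (t : 'I_T) (w : Omega) : R :=
  \sum_(n < N) (da_price D t w <= pbuy y t n)%R%:R * xbuy y t n.

(* The sequence s_0, s_1, ..., s_T: the given initial state followed by the
   decision variables. *)
Definition soc_path y (k : 'I_T.+1) : R :=
  if unlift ord0 k is Some t then soc y t else soc_init D.

Record feasible y : Prop := Feasible {
  revenue_def : forall w,
    revenue y w = \sum_(t < T) da_price D t w * (sold y t w - bought y t w);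
  excess_ge_loss : forall w, - revenue y w - tau y <= excess y w;
  excess_ge0 : forall w, 0 <= excess y w;
  soc_dynamics : forall t : 'I_T,
    soc_path y (lift ord0 t) =
    soc_path y (widen_ord (leqnSn T) t) +
    \sum_(w : Omega) weight D w *
      (efficiency D * bought y t w - (efficiency D)^-1 * sold y t w);
  soc_bounds : forall t, soc_min D <= soc y t <= soc_max D;
  xsell_ge0 : forall t n, 0 <= xsell y t n;
  xbuy_ge0 : forall t n, 0 <= xbuy y t n;
  xsell_limit : forall t, \sum_(n < N) xsell y t n <= power_limit D;
  xbuy_limit : forall t, \sum_(n < N) xbuy y t n <= power_limit D;
  pbuy_le_psell : forall t n m, pbuy y t m <= psell y t n
}.

Definition objective y : R :=
  risk_weight D * (\sum_(w : Omega) weight D w * revenue y w) -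
  (1 - risk_weight D) *
    (tau y + (1 - confidence D)^-1 * \sum_(w : Omega) weight D w * excess y w).

Definition optimal y : Prop :=
  feasible y /\ forall y', feasible y' -> objective y' <= objective y.

Definition sampled_prices (t : 'I_T) : seq R := codom (da_price D t).

End BatteryBidding.

(* Main.v *)
(* Moving each selling price up and each buying price down to the nearest
   sampled price of its hour changes no acceptance indicator; bids lying beyond
   all samples are never accepted, so their quantity is set to 0 and their price
   to the extreme sample. Hence every feasible point has the same objective value
   as a feasible point with sampled prices, and only finitely many price
   assignments matter. For each of them the objective attains its maximum by
   compactness: r and z are determined by the other variables, and tau may be
   clamped to [-M, M], where M bounds the scenario revenues, because
   1 / (1 - alpha) >= 1. *)

Require Import Defs.
From mathcomp Require Import all_boot all_order all_algebra.
From mathcomp Require Import reals.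
From mathcomp Require Import boolp classical_sets topology normedtype derive lra.

Set Implicit Arguments.
Unset Strict Implicit.
Unset Printing Implicit Defensive.

Import Order.TTheory GRing.Theory Num.Theory numFieldNormedType.Exports.
Local Open Scope ring_scope.

(** * Rounding a real number to a finite set of samples *)

Section Rounding.
Variables (R : realDomainType) (Omega : finType).
Hypothesis Omega_gt0 : (0 < #|Omega|)%N.

(** If some sample is at least [p], take for [w0] the smallest such sample; otherwise take the
    largest sample, and both sides of the equality are false. The second clause serves to keep
    buying prices below selling prices after rounding. *)
Lemma round_up (g : Omega -> R) (p : R) : exists w0 : Omega,
  (forall w, (p <= g w) = (p <= g w0) && (g w0 <= g w)) /\
  ((p <= g w0) || [forall w, g w <= g w0]).
Proof.
have /card_gt0P[a _] := Omega_gt0.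
have [[b pb]|none] := pselect (exists b, p <= g b).
- case: (@arg_minP _ _ _ b (fun w => p <= g w) g pb) => w0 pw0 minw0.
  exists w0; split; last by rewrite pw0.
  move=> w; rewrite pw0 /=; apply/idP/idP; first exact: minw0.
  exact: le_trans.
- case: (@arg_maxP _ _ _ a xpredT g isT) => w0 _ maxw0; exists w0.
  have nle w : (p <= g w) = false by apply/negP => pw; apply: none; exists w.
  split=> [w|]; first by rewrite !nle.
  by apply/orP; right; apply/forallP => w; apply: maxw0.
Qed.

Lemma round_down (g : Omega -> R) (p : R) : exists w0 : Omega,
  (forall w, (g w <= p) = (g w0 <= p) && (g w <= g w0)) /\
  ((g w0 <= p) || [forall w, g w0 <= g w]).
Proof.
have [w0 [eq0 le0]] := round_up (fun w => - g w) (- p); exists w0; split.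
  by move=> w; have := eq0 w; rewrite !lerN2.
move: le0; rewrite lerN2 => /orP[->//|/forallP le0].
by apply/orP; right; apply/forallP => w; rewrite -lerN2.
Qed.

End Rounding.

(** * Continuity, closed sets and maxima on boxes *)

Section Continuity.
Local Open Scope classical_set_scope.

Lemma continuous_sum (R : realType) (X : topologicalType) (J : finType)
    (F : J -> X -> R) :
  (forall j, continuous (F j)) -> continuous (fun v => \sum_j F j v).
Proof. by move=> cF; apply: continuous_big => //; exact: add_continuous. Qed.

Lemma continuous_scale (R : realType) (X : topologicalType) (c : R)
    (F : X -> R) :
  continuous F -> continuous (fun v => c * F v).
Proof. by move=> cF v; apply: cvgM (cF v); exact: cvg_cst. Qed.

Lemma continuous_add (R : realType) (X : topologicalType) (F G : X -> R) :
  continuous F -> continuous G -> continuous (fun v => F v + G v).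
Proof. by move=> cF cG v; exact: cvgD (cF v) (cG v). Qed.

Lemma continuous_sub (R : realType) (X : topologicalType) (F G : X -> R) :
  continuous F -> continuous G -> continuous (fun v => F v - G v).
Proof. by move=> cF cG v; exact: cvgB (cF v) (cG v). Qed.

Lemma continuous_opp (R : realType) (X : topologicalType) (F : X -> R) :
  continuous F -> continuous (fun v => - F v).
Proof. by move=> cF v; exact: cvgN (cF v). Qed.

Lemma continuous_pos_part (R : realType) (X : topologicalType) (F : X -> R) :
  continuous F -> continuous (fun v => Num.max 0 (F v)).
Proof.
move=> cF v.
exact: (continuous_max (f := fun=> 0) (g := F) (@cst_continuous _ _ 0 v) (cF v)).
Qed.

Lemma closed_le_continuous (R : realType) (X : topologicalType) (F : X -> R)
    (c : R) : continuous F -> closed [set v | F v <= c].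
Proof. by move=> /continuous_closedP/(_ _ (@closed_le _ c)). Qed.

Lemma closed_eq_continuous (R : realType) (X : topologicalType)
    (F G : X -> R) :
  continuous F -> continuous G -> closed [set v | F v = G v].
Proof.
move=> cF cG.
have /continuous_closedP/(_ _ (@closed_eq _ 0)) : continuous (fun v => F v - G v).
  exact: continuous_sub.
congr closed; apply/seteqP; split=> v /=.
  by move/eqP; rewrite subr_eq0 => /eqP.
by move=> ->; rewrite subrr.
Qed.

Lemma closed_forall (X : topologicalType) (J : Type) (P : J -> X -> Prop) :
  (forall j, closed [set v | P j v]) -> closed [set v | forall j, P j v].
Proof.
move=> cP; have -> : [set v | forall j, P j v] = \bigcap_j [set v | P j v].
  by apply/seteqP; split=> v /= Pv j; [move=> _|]; exact: Pv.
by apply: closed_bigI => j _.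
Qed.

Lemma continuous_proj (R : realType) (I : eqType) (i : I) :
  continuous (fun v : {ptws I -> R} => v i).
Proof. exact: (@proj_continuous I (fun=> R) i). Qed.

(** In the topology of pointwise convergence the box is compact by Tychonoff, so its intersection
    with the closed set [C] is compact and the extreme value theorem applies. *)
Lemma max_on_box (R : realType) (I : eqType) (lo hi : I -> R)
    (C : set {ptws I -> R}) (f : {ptws I -> R} -> R) :
  closed C -> continuous f ->
  (exists v : I -> R, C v /\ forall i, lo i <= v i <= hi i) ->
  exists v : I -> R, [/\ C v, forall i, lo i <= v i <= hi i &
    forall v' : I -> R, C v' -> (forall i, lo i <= v' i <= hi i) -> f v' <= f v].
Proof.
move=> cC cf [v0 [Cv0 bv0]].
pose B := [set v : {ptws I -> R} | forall i, `[lo i, hi i] (v i)].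
have cB : compact B.
  exact: (@tychonoff I (fun=> R) _ (fun i => @segment_compact R (lo i) (hi i))).
have BC0 : B `&` C !=set0 by exists v0; split=> // i; rewrite /= in_itv /=.
have [v] := compact_EVT_max BC0 (compact_closedI cB cC) (continuous_subspaceT cf).
rewrite inE => -[Bv Cv] maxv; exists v; split=> //.
by move=> v' Cv' bv'; apply: maxv; rewrite inE; split=> // i; rewrite /= in_itv.
Qed.

End Continuity.

(** * Replacing bid prices by sampled prices *)

Section Battery.
Variables (R : realType) (Omega : finType) (T N : nat).
Variable D : battery_data R Omega T.
Hypothesis D_valid : valid_data D.
Implicit Type y : decision R Omega T N.

(** Prices are recorded by scenario indices [fs] and [fb], so that the price assignments range over
    a finite type. *)
Lemma sampled_price_rounding y : feasible D y ->
  exists (fs fb : {ffun 'I_T * 'I_N -> Omega}) y',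
  [/\ feasible D y', objective D y' = objective D y,
      psell y' = (fun t n => da_price D t (fs (t, n))) &
      pbuy y' = (fun t n => da_price D t (fb (t, n)))].
Proof.
move=> fy; have On := scenarios_nonempty D_valid.
have [fs fsP] := choice (fun i : 'I_T * 'I_N =>
  round_up On (da_price D i.1) (psell y i.1 i.2)).
have [fb fbP] := choice (fun i : 'I_T * 'I_N =>
  round_down On (da_price D i.1) (pbuy y i.1 i.2)).
(* The test that switches a quantity off is the first factor of the conjunction given by the
   rounding lemmas. Accepted volumes are thus unchanged in every scenario, and the remaining
   variables can be kept. *)
pose y' := Decision
  (fun t n => if psell y t n <= da_price D t (fs (t, n))
              then xsell y t n else 0)
  (fun t n => if da_price D t (fb (t, n)) <= pbuy y t n
              then xbuy y t n else 0)
  (fun t n => da_price D t (fs (t, n)))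
  (fun t n => da_price D t (fb (t, n)))
  (soc y) (tau y) (excess y) (revenue y).
have sE t w : sold D y' t w = sold D y t w.
  apply: eq_bigr => n _ /=; have [/(_ w)-> _] := fsP (t, n) => /=.
  by case: ifP => _ /=; rewrite ?mulr0 ?mul0r.
have bE t w : bought D y' t w = bought D y t w.
  apply: eq_bigr => n _ /=; have [/(_ w)-> _] := fbP (t, n) => /=.
  by case: ifP => _ /=; rewrite ?mulr0 ?mul0r.
exists (finfun fs), (finfun fb), y'; split=> //; last first.
- by apply/funext => t; apply/funext => n; rewrite ffunE.
- by apply/funext => t; apply/funext => n; rewrite ffunE.
case: fy => rD eL e0 sD sB xs0 xb0 xsL xbL pp; split=> //=.
- by move=> w; rewrite rD; apply: eq_bigr => t _; rewrite sE bE.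
- move=> t; rewrite [LHS]sD; congr (_ + _).
  by apply: eq_bigr => w _; rewrite sE bE.
- by move=> t n; case: ifP.
- by move=> t n; case: ifP.
- by move=> t; apply: le_trans (xsL t); apply: ler_sum => n _; case: ifP.
- by move=> t; apply: le_trans (xbL t); apply: ler_sum => n _; case: ifP.
(* Either the selling price went up and the buying price went down, or one of them is an extreme
   sample of the hour, which bounds every other sample. *)
- move=> t n m; have [_ /orP[les|/forallP maxs]] := fsP (t, n); last exact: maxs.
  have [_ /orP[leb|/forallP minb]] := fbP (t, m); last exact: minb.
  exact: le_trans leb (le_trans (pp t n m) les).
Qed.

(** * Eliminating the revenues and CVaR variables, and bounding [tau] *)

Definition profit y (w : Omega) : R :=
  \sum_(t < T) da_price D t w * (sold D y t w - bought D y t w).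

(** Keeps the bids, sets [tau] to [a], and gives [excess] the least value that its two constraints
    allow. *)
Definition settle y (a : R) : decision R Omega T N :=
  Decision (xsell y) (xbuy y) (psell y) (pbuy y) (soc y) a
    (fun w => Num.max 0 (- profit y w - a)) (profit y).

Lemma settle_feasible y (a : R) : feasible D y -> feasible D (settle y a).
Proof.
case=> rD eL e0 sD sB xs0 xb0 xsL xbL pp; split=> //=.
- by move=> w; rewrite le_max lexx orbT.
- by move=> w; rewrite le_max lexx.
Qed.

(** The sum over scenarios stands in for a maximum: its terms are nonnegative, so one number bounds
    the profit of every scenario. *)
Definition profit_bound : R :=
  \sum_(w : Omega) \sum_(t < T) `|da_price D t w| * power_limit D.

(** In each hour the sold and bought volumes both lie between 0 and [power_limit D], hence so does
    the absolute value of their difference. *)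
Lemma profit_bounded y w : feasible D y -> `|profit y w| <= profit_bound.
Proof.
case=> rD eL e0 sD sB xs0 xb0 xsL xbL pp.
have L0 := power_limit_ge0 D_valid.
rewrite /profit_bound (bigD1 w) //= -[leLHS]addr0; apply: lerD; last first.
  by apply: sumr_ge0 => v _; apply: sumr_ge0 => t _; rewrite mulr_ge0.
apply: (le_trans (ler_norm_sum _ _ _)); apply: ler_sum => t _.
rewrite normrM ler_wpM2l //.
have bit01 (b : bool) (x : R) : 0 <= x -> 0 <= b%:R * x <= x.
  by case: b => x0; rewrite ?mul1r ?mul0r x0 lexx.
have s0 : 0 <= sold D y t w.
  apply: sumr_ge0 => n _.
  by have /andP[] := bit01 (psell y t n <= da_price D t w) _ (xs0 t n).
have b0 : 0 <= bought D y t w.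
  apply: sumr_ge0 => n _.
  by have /andP[] := bit01 (da_price D t w <= pbuy y t n) _ (xb0 t n).
have sL : sold D y t w <= power_limit D.
  apply: le_trans (xsL t); apply: ler_sum => n _.
  by have /andP[] := bit01 (psell y t n <= da_price D t w) _ (xs0 t n).
have bL : bought D y t w <= power_limit D.
  apply: le_trans (xbL t); apply: ler_sum => n _.
  by have /andP[] := bit01 (da_price D t w <= pbuy y t n) _ (xb0 t n).
by rewrite ler_norml; apply/andP; split; lra.
Qed.

Lemma profit_bound_ge0 : 0 <= profit_bound.
Proof.
have L0 := power_limit_ge0 D_valid.
by apply: sumr_ge0 => v _; apply: sumr_ge0 => t _; rewrite mulr_ge0.
Qed.

(** If [a > M], then [b = M] and [e = 0], since no loss exceeds [M]. If [a < - M], then [b = - M]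
    and [e = M - r], so the excess drops by at least the increase [b - a]. *)
Lemma clamped_excess (M a r z : R) : `|r| <= M -> - r - a <= z -> 0 <= z ->
  let b := Num.max (- M) (Num.min M a) in
  let e := Num.max 0 (- r - b) in e <= z /\ b - a <= z - e.
Proof.
rewrite ler_norml => /andP[rM1 rM2] z1 z2 /=.
have [h1|h1] := leP M a; have [h2|h2] := leP (- M) _;
  have [h3|h3] := leP 0 _; split; lra.
Qed.

Lemma settle_improves y : feasible D y ->
  exists2 a, - profit_bound <= a <= profit_bound &
    objective D y <= objective D (settle y a).
Proof.
move=> fy; have M0 := profit_bound_ge0.
pose a := Num.max (- profit_bound) (Num.min profit_bound (tau y)).
exists a.
  by rewrite le_max lexx /= ge_max ge_min lexx andbT; lra.
have rE w : revenue y w = profit y w by rewrite (revenue_def fy).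
have key w : Num.max 0 (- profit y w - a) <= excess y w /\
    a - tau y <= excess y w - Num.max 0 (- profit y w - a).
  have loss : - profit y w - tau y <= excess y w.
    by rewrite -rE; exact: (excess_ge_loss fy).
  exact: (clamped_excess (profit_bounded w fy) loss (excess_ge0 fy w)).
rewrite /objective /=.
under eq_bigr do rewrite rE.
rewrite lerD2l lerN2 ler_wpM2l //.
  by have /andP[_] := risk_weight_in D_valid; rewrite subr_ge0.
(* [S] is the expected drop in excess. It must pay for the change [a - tau y]: it is at least that
   large, and being nonnegative it only grows under the factor [(1 - confidence D)^-1]. *)
pose S := \sum_w weight D w *
  (excess y w - Num.max 0 (- profit y w - a)).
have SE : S = \sum_w weight D w * excess y w -
    \sum_w weight D w * Num.max 0 (- profit y w - a).
  by rewrite -sumrB; apply: eq_bigr => w _; rewrite mulrBr.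
have S0 : 0 <= S.
  apply: sumr_ge0 => w _; rewrite mulr_ge0 ?(ltW (weight_gt0 D_valid w)) //.
  by rewrite subr_ge0; have [] := key w.
have Sa : a - tau y <= S.
  (* The constant [a - tau y] is written as its own weighted mean, to be compared scenario by
     scenario. *)
  rewrite -[leLHS]mul1r -(weight_sum1 D_valid) mulr_suml.
  apply: ler_sum => w _; rewrite ler_wpM2l ?(ltW (weight_gt0 D_valid w)) //.
  by have [] := key w.
have /andP[c0 c1] := confidence_in D_valid.
have k1 : 1 <= (1 - confidence D)^-1 by rewrite invf_ge1; lra.
have : S <= (1 - confidence D)^-1 * S by rewrite ler_peMl.
by rewrite {2}SE mulrBr; lra.
Qed.

(** * Existence of an optimum for fixed prices *)

Lemma idle_feasible (ps pb : 'I_T -> 'I_N -> R) :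
  (forall t n m, pb t m <= ps t n) ->
  exists y, [/\ feasible D y, psell y = ps & pbuy y = pb].
Proof.
move=> pp.
(* Without trading the state of charge stays at its admissible initial value; this point later makes
   the compact set nonempty. *)
pose y0 : decision R Omega T N := Decision (fun _ _ => 0) (fun _ _ => 0) ps pb
  (fun=> soc_init D) 0 (fun=> 0) (fun=> 0).
have s0 t w : sold D y0 t w = 0 by rewrite /sold big1 // => n _; rewrite mulr0.
have b0 t w : bought D y0 t w = 0.
  by rewrite /bought big1 // => n _; rewrite mulr0.
have p0 k : soc_path D y0 k = soc_init D by rewrite /soc_path; case: unlift.
have L0 := power_limit_ge0 D_valid.
exists y0; split=> //; split=> //=.
- by move=> w; rewrite big1 // => t _; rewrite s0 b0 subrr mulr0.
- by move=> w; rewrite subr0 oppr0.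
- move=> t; rewrite !p0 big1 ?addr0 // => w _.
  by rewrite s0 b0 !mulr0 subrr mulr0.
- by move=> t; exact: (soc_init_in D_valid).
- by move=> t; rewrite big1.
- by move=> t; rewrite big1.
Qed.

Section FixedPrices.
Variables ps pb : 'I_T -> 'I_N -> R.
Hypothesis pb_le_ps : forall t n m, pb t m <= ps t n.

(** One index per free real variable: sold quantities, bought quantities, states of charge, [tau]. A
    decision becomes a point of a single product space. *)
Definition coord : eqType :=
  (('I_T * 'I_N) + ('I_T * 'I_N) + 'I_T + unit)%type.

Definition sell_coord t n : coord := inl (inl (inl (t, n))).
Definition buy_coord t n : coord := inl (inl (inr (t, n))).
Definition soc_coord t : coord := inl (inr t).
Definition tau_coord : coord := inr tt.

(** The zeros are placeholders that [settle] overwrites. *)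
Definition decode (v : {ptws coord -> R}) : decision R Omega T N :=
  settle (Decision (fun t n => v (sell_coord t n)) (fun t n => v (buy_coord t n))
    ps pb (fun t => v (soc_coord t)) 0 (fun=> 0) (fun=> 0)) (v tau_coord).

Definition encode y : coord -> R := fun i =>
  match i with
  | inl (inl (inl (t, n))) => xsell y t n
  | inl (inl (inr (t, n))) => xbuy y t n
  | inl (inr t) => soc y t
  | inr _ => tau y
  end.

Definition lower (i : coord) : R :=
  match i with
  | inl (inl _) => 0
  | inl (inr _) => soc_min D
  | inr _ => - profit_bound
  end.

Definition upper (i : coord) : R :=
  match i with
  | inl (inl _) => power_limit D
  | inl (inr _) => soc_max D
  | inr _ => profit_bound
  end.

Lemma decode_encode y a : psell y = ps -> pbuy y = pb ->
  decode (encode (settle y a)) = settle y a.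
Proof. by case: y => ? ? ? ? ? ? ? ? /= -> ->. Qed.

Lemma encode_box y : feasible D y ->
  - profit_bound <= tau y <= profit_bound ->
  forall i, lower i <= encode y i <= upper i.
Proof.
move=> fy ty [[[[t n]|[t n]]|t]|[]] //=; last exact: (soc_bounds fy).
- rewrite (xsell_ge0 fy) /=; apply: le_trans (xsell_limit fy t).
  by rewrite (bigD1 n) //= lerDl sumr_ge0 // => m _; exact: (xsell_ge0 fy).
- rewrite (xbuy_ge0 fy) /=; apply: le_trans (xbuy_limit fy t).
  by rewrite (bigD1 n) //= lerDl sumr_ge0 // => m _; exact: (xbuy_ge0 fy).
Qed.

(** The constraints that couple coordinates. Bounds on single coordinates are left to the box, and
    those on [revenue] and [excess] hold by construction of [decode]. *)
Definition linked (v : {ptws coord -> R}) : Prop :=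
  [/\ forall t, soc_path D (decode v) (lift ord0 t) =
        soc_path D (decode v) (widen_ord (leqnSn T) t) +
        \sum_(w : Omega) weight D w *
          (efficiency D * bought D (decode v) t w -
           (efficiency D)^-1 * sold D (decode v) t w),
      forall t, \sum_(n < N) v (sell_coord t n) <= power_limit D &
      forall t, \sum_(n < N) v (buy_coord t n) <= power_limit D].

Lemma linked_feasible v : linked v -> (forall i, lower i <= v i <= upper i) ->
  feasible D (decode v).
Proof.
case=> dyn sL bL box; split=> //=.
- by move=> w; rewrite le_max lexx orbT.
- by move=> w; rewrite le_max lexx.
- by move=> t; exact: (box (soc_coord t)).
- by move=> t n; have /andP[] := box (sell_coord t n).
- by move=> t n; have /andP[] := box (buy_coord t n).
Qed.

Lemma feasible_linked v : feasible D (decode v) -> linked v.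
Proof. by case=> rD eL e0 sD sB xs0 xb0 xsL xbL pp; split. Qed.

(** With the prices fixed, the acceptance indicators are constants and the volume is linear in the
    quantities. *)
Lemma sold_continuous t w : continuous (fun v => sold D (decode v) t w).
Proof.
apply: continuous_sum => n /=; apply: continuous_scale; exact: continuous_proj.
Qed.

Lemma bought_continuous t w : continuous (fun v => bought D (decode v) t w).
Proof.
apply: continuous_sum => n /=; apply: continuous_scale; exact: continuous_proj.
Qed.

Lemma soc_path_continuous k : continuous (fun v => soc_path D (decode v) k).
Proof.
rewrite /soc_path; case: unlift => [t|]; last exact: cst_continuous.
exact: continuous_proj.
Qed.

Lemma profit_continuous w : continuous (fun v => profit (decode v) w).
Proof.
apply: continuous_sum => t; apply: continuous_scale; apply: continuous_sub.
  exact: sold_continuous.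
exact: bought_continuous.
Qed.

Lemma linked_closed : closed [set v | linked v]%classic.
Proof.
rewrite (_ : [set v | linked v]%classic =
  ([set v | forall t, soc_path D (decode v) (lift ord0 t) =
        soc_path D (decode v) (widen_ord (leqnSn T) t) +
        \sum_(w : Omega) weight D w *
          (efficiency D * bought D (decode v) t w -
           (efficiency D)^-1 * sold D (decode v) t w)] `&`
   [set v : {ptws coord -> R} |
     forall t, (\sum_(n < N) v (sell_coord t n) <= power_limit D : Prop)] `&`
   [set v : {ptws coord -> R} |
     forall t, (\sum_(n < N) v (buy_coord t n) <= power_limit D : Prop)])%classic);
  last by apply/seteqP; split=> v /=; [case|case=> -[]].
apply: closedI; first apply: closedI.
- apply: closed_forall => t; apply: closed_eq_continuous.
    exact: soc_path_continuous.
  apply: continuous_add; first exact: soc_path_continuous.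
  apply: continuous_sum => w; apply: continuous_scale; apply: continuous_sub.
    by apply: continuous_scale; exact: bought_continuous.
  by apply: continuous_scale; exact: sold_continuous.
- apply: closed_forall => t; apply: closed_le_continuous.
  by apply: continuous_sum => n; exact: continuous_proj.
- apply: closed_forall => t; apply: closed_le_continuous.
  by apply: continuous_sum => n; exact: continuous_proj.
Qed.

Lemma objective_continuous : continuous (fun v => objective D (decode v)).
Proof.
apply: continuous_sub; apply: continuous_scale.
  apply: continuous_sum => w; apply: continuous_scale.
  exact: profit_continuous.
apply: continuous_add; first exact: continuous_proj.
apply: continuous_scale; apply: continuous_sum => w; apply: continuous_scale.
apply: continuous_pos_part; apply: continuous_sub; last exact: continuous_proj.
by apply: continuous_opp; exact: profit_continuous.
Qed.

Lemma optimal_for_prices : exists y,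
  [/\ feasible D y, psell y = ps, pbuy y = pb &
      forall y', feasible D y' -> psell y' = ps -> pbuy y' = pb ->
        objective D y' <= objective D y].
Proof.
(* Every feasible decision with these prices is dominated by a linked point of the box, so a maximum
   over such points is a maximum over all of them. *)
have settled y : feasible D y -> psell y = ps -> pbuy y = pb ->
    exists v : coord -> R, [/\ linked v, forall i, lower i <= v i <= upper i &
      objective D y <= objective D (decode v)].
  move=> fy ys yb; have [a aM ya] := settle_improves fy.
  have fa := settle_feasible a fy.
  exists (encode (settle y a)); rewrite decode_encode //; split=> //.
    by apply: feasible_linked; rewrite decode_encode.
  exact: encode_box.
have [y0 [fy0 y0s y0b]] := idle_feasible pb_le_ps.
have [v0 [lv0 bv0 _]] := settled _ fy0 y0s y0b.
have [|v [lv bv maxv]] :=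
  max_on_box (lo := lower) (hi := upper) linked_closed objective_continuous.
  by exists v0.
exists (decode v); split=> //; first exact: linked_feasible.
move=> y fy ys yb; have [v' [lv' bv' yv']] := settled _ fy ys yb.
by apply: le_trans yv' _; exact: maxv.
Qed.

End FixedPrices.

End Battery.

(** * Choosing the best among finitely many price assignments *)

Theorem lemma2p1 (R : realType) (Omega : finType) (T N : nat)
    (T_ge1 : (1 <= T)%N) (N_ge1 : (1 <= N)%N)
    (D : battery_data R Omega T) (D_valid : valid_data D) :
  exists y : decision R Omega T N,
    optimal D y /\
    forall (t : 'I_T) (n m : 'I_N),
      psell y t n \in sampled_prices D t /\ pbuy y t m \in sampled_prices D t.
Proof.
pose F := {ffun 'I_T * 'I_N -> Omega}.
pose price (f : F) t n := da_price D t (f (t, n)).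
pose ok (f : F * F) :=
  [forall t, forall n, forall m, price f.2 t m <= price f.1 t n].
have okP f : reflect (forall t n m, price f.2 t m <= price f.1 t n) (ok f).
  apply: (iffP forallP) => [h t n m|h t].
    by have /forallP/(_ n)/forallP := h t.
  by apply/forallP => n; apply/forallP => m.
(* The implication under the existential makes [Y] total: assignments violating the price order
   receive a dummy zero decision. *)
have ex f : exists y : decision R Omega T N, ok f ->
    [/\ feasible D y, psell y = price f.1, pbuy y = price f.2 &
      forall y', feasible D y' -> psell y' = price f.1 ->
        pbuy y' = price f.2 -> objective D y' <= objective D y].
  have [/okP okf|nokf] := boolP (ok f).
    by have [y] := optimal_for_prices D_valid okf; exists y.
  by exists (Decision (fun _ _ => 0) (fun _ _ => 0) (fun _ _ => 0)
    (fun _ _ => 0) (fun=> 0) 0 (fun=> 0) (fun=> 0)).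
have [Y YP] := choice ex.
have /card_gt0P[a _] := scenarios_nonempty D_valid.
(* Using one scenario for all bids makes the prices of each hour equal, so some assignment respects
   the order. *)
have ok0 : ok ([ffun=> a], [ffun=> a]).
  by apply/okP => t n m; rewrite /price !ffunE.
case: (arg_maxP (fun f => objective D (Y f)) ok0) => f okf maxf.
have [fY Ys Yb _] := YP f okf.
exists (Y f); split; last first.
  by move=> t n m; rewrite Ys Yb; split; exact: codom_f.
(* An arbitrary competitor is rounded, then compared with the optimum for its rounded prices, and
   that one with the best assignment [f]. *)
split=> // y fy; have [fs [fb [y' [fy' <- y's y'b]]]] :=
  sampled_price_rounding D_valid fy.
have okg : ok (fs, fb).
  by apply/okP => t n m; have := pbuy_le_psell fy' t n m; rewrite y's y'b.
have [_ _ _ maxg] := YP _ okg.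
by apply: le_trans (maxf _ okg); exact: maxg.
Qed.
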